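(* Let $C:f=0$ be a reduced curve in $\mathbb{P}^2$ and let $L$ be a line in $\mathbb{P}^2$ which is not an irreducible component of $C$. Consider the union $C'=C\cup L:f'=0$ and assume that $C$ is a free curve. Then $C'$ is either a free curve or a plus-one generated curve.
   Context: Let $S=\mathbb{C}[x,y,z]$. For a reduced homogeneous polynomial $f\in S$ of degree $d$ defining a plane curve $C:f=0$ (the paper works with reduced curves of degree $d\ge 3$), let $D_0(f)=\{(a,b,c)\in S^3 : af_x+bf_y+cf_z=0\}$ be the graded $S$-module of Jacobian syzygies. If $D_0(f)$ is minimally generated by $m$ homogeneous elements, of degrees $d_1\le d_2\le\dots\le d_m$ (these are independent of the choice of minimal generators), the degrees $(d_1,\dots,d_m)$ are called the exponents of $C$. The curve $C$ is free if $m=2$ (i.e. $D_0(f)$ is a free $S$-module of rank 2), and $C$ is plus-one generated if $m=3$ and $d_1+d_2=d$. *)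

(* Defs.v *)
From HB Require Import structures.
From mathcomp Require Import all_boot all_algebra.
From mathcomp Require Import complex reals.
From mathcomp Require Import mpoly.

Set Implicit Arguments.
Unset Strict Implicit.
Unset Printing Implicit Defensive.

Import GRing.Theory.
Local Open Scope ring_scope.

Section JacobianSyzygies.
Variable R : realType.
Local Notation S := {mpoly R[i][3]}.

Definition reduced (f : S) : Prop :=
  f != 0 /\ forall g h : S, f = g * g * h -> (msize g <= 1)%N.

Definition jac_syzygy (f : S) (v : 'I_3 -> S) : Prop :=
  \sum_(j < 3) v j * f^`M(j) = 0.

Definition homog_triple (k : nat) (v : 'I_3 -> S) : Prop :=
  forall j, v j \is k.-homog.

Definition homog_gen_system (f : S) (n : nat)
    (deg : 'I_n -> nat) (gen : 'I_n -> 'I_3 -> S) : Prop :=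
  (forall k, ~ (forall j, gen k j = 0) /\ homog_triple (deg k) (gen k)
             /\ jac_syzygy f (gen k)) /\
  (forall v, jac_syzygy f v ->
     exists c : 'I_n -> S, forall j, v j = \sum_(k < n) c k * gen k j).

Definition min_num_gens (f : S) (m : nat) : Prop :=
  (exists deg gen, homog_gen_system f deg gen (n := m)) /\
  (forall n deg gen, @homog_gen_system f n deg gen -> (m <= n)%N).

Definition free_curve (f : S) : Prop := min_num_gens f 2.

(* f of degree d is plus-one generated: m = 3 and the exponents
   d1 <= d2 <= d3 (degrees of a minimal homogeneous generating system)
   satisfy d1 + d2 = d. *)
Definition plus_one_generated (d : nat) (f : S) : Prop :=
  min_num_gens f 3 /\
  exists (deg : 'I_3 -> nat) (gen : 'I_3 -> 'I_3 -> S),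
    homog_gen_system f deg gen /\
    (forall i j : 'I_3, (i <= j)%N -> (deg i <= deg j)%N) /\
    (deg (inord 0) + deg (inord 1))%N = d.

End JacobianSyzygies.

(* Main.v *)
Require Import Defs.
From HB Require Import structures.
From mathcomp Require Import all_boot all_algebra.
From mathcomp Require Import complex reals.
From mathcomp Require Import mpoly.
From mathcomp Require Import all_order zify ring.
From Stdlib Require Import Classical.

(* Write S = C[x,y,z], E for the Euler derivation, and let r1, r2 be a basis of D_0(f), of
   degrees d1 <= d2. Since f is reduced its partial derivatives have no common factor, and
   comparing r1 x r2 with the gradient through the Koszul syzygies gives
   r1 x r2 = const * grad f, hence d1 + d2 = d - 1.
   Put alpha = r1(l) and beta = r2(l). Correcting by a multiple of E identifies D_0(f l) with
   the module of the pairs (a, b) such that l divides a alpha + b beta. If g is the gcd of alpha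
   and beta modulo l, with alpha = g A and beta = g B modulo l, this module is generated by
   (l, 0), (0, l) and (B, -A), which have degrees d1 + 1, d2 + 1 and d2 + deg A. If A is a
   constant, (0, l) is superfluous and the curve is free; if A is not constant the degrees are
   increasing and (d1 + 1) + (d2 + 1) = d + 1. The cases where l divides alpha are immediate.
   The gcd exists because polynomial rings over a field are factorial. *)

Set Implicit Arguments.
Unset Strict Implicit.
Unset Printing Implicit Defensive.
Import Order.TTheory GRing.Theory Num.Theory.
Local Open Scope ring_scope.

(** * Factoriality of polynomial rings *)

Section Divisibility.
Variable A : idomainType.
Implicit Types a b p q : A.

Definition divides a b : Prop := exists c, b = c * a.

Definition prime_elt p : Prop :=
  [/\ p != 0, p \isn't a GRing.unit
    & forall a b, divides p (a * b) -> divides p a \/ divides p b].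

Definition irreducible_elt p : Prop :=
  [/\ p != 0, p \isn't a GRing.unit
    & forall a b, p = a * b -> a \is a GRing.unit \/ b \is a GRing.unit].

(** Factorisation is phrased with prime factors, so that an induction can cancel them one at a
    time. *)
Inductive prime_prod : A -> Prop :=
| prime_prod_unit u : u \is a GRing.unit -> prime_prod u
| prime_prod_mul p a : prime_elt p -> prime_prod a -> prime_prod (p * a).

Lemma dividesD a b c : divides a b -> divides a c -> divides a (b + c).
Proof. by move=> [x ->] [y ->]; exists (x + y); rewrite mulrDl. Qed.

Lemma dividesN a b : divides a b -> divides a (- b).
Proof. by move=> [x ->]; exists (- x); rewrite mulNr. Qed.

Lemma dividesB a b c : divides a b -> divides a c -> divides a (b - c).
Proof. by move=> ab /dividesN; exact: dividesD. Qed.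

Lemma divides_mull a b c : divides a b -> divides a (c * b).
Proof. by move=> [x ->]; exists (c * x); rewrite mulrA. Qed.

Lemma divides_mulr a b c : divides a b -> divides a (b * c).
Proof. by rewrite mulrC; exact: divides_mull. Qed.

Lemma divides_addl a b c : divides a c -> divides a (b + c) -> divides a b.
Proof. by move=> ac /dividesB/(_ ac); rewrite addrK. Qed.

Lemma divides_unit a u : u \is a GRing.unit -> divides u a.
Proof. by move=> uu; exists (a / u); rewrite divrK. Qed.

Lemma prime_prodM a b : prime_prod a -> prime_prod b -> prime_prod (a * b).
Proof.
move=> pa pb; elim: pa => [u uu|p c pp _ IH]; last first.
  by rewrite -mulrA; exact: prime_prod_mul.
elim: pb => [v uv|p c pp _ IH]; first by apply: prime_prod_unit; rewrite unitrM uu.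
by rewrite mulrCA; exact: prime_prod_mul.
Qed.

(** The cofactor of the first prime in the factorisation is a unit, so [p] is an associate of that
    prime. *)
Lemma irreducible_prime_of_prod p : irreducible_elt p -> prime_prod p -> prime_elt p.
Proof.
move=> [_ pu pirr] pp; case: pp pu pirr => [u -> //|q a qp _] _ /(_ q a erefl).
case=> [qu|au]; first by case: qp => _; rewrite qu.
case: qp => q0 qu qp; split; first by rewrite mulf_neq0 //; apply: contraTneq au => ->; rewrite unitr0.
  by rewrite unitrM (negbTE qu).
move=> x y [c e]; have /qp : divides q (x * y) by exists (c * a); rewrite e; ring.
by case=> -[z ->]; [left|right]; exists (z / a); rewrite [q * a]mulrC mulrA divrK.
Qed.

End Divisibility.
Arguments divides {A}.

(** * Gauss's lemma and primes of [{poly A}] *)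

Section PolyPrime.
Variable A : idomainType.
Implicit Types (c p : A) (q g h : {poly A}).

Lemma prime_polyC p : prime_elt p -> prime_elt p%:P.
Proof.
move=> [p0 pu pp]; split; rewrite ?polyC_eq0 //.
  by rewrite poly_unitE coefC eqxx (negbTE pu) andbF.
move=> g h; have [n] := ubnP (size g + size h); elim: n g h => // n IH g h.
have div0 g' : divides p%:P g' -> divides p g'`_0.
  by move=> [c ->]; exists c`_0; rewrite coefMC.
have divC c : divides p c -> divides p%:P c%:P.
  by move=> [x ->]; exists x%:P; rewrite polyCM.
have divMX g' : divides p%:P (g' * 'X) -> divides p%:P g'.
  case; elim/poly_ind => [|c b _] e.
    by exists 0; move/eqP: e; rewrite !mul0r mulf_eq0 polyX_eq0 orbF => /eqP.
  have b0 : b = 0.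
    move/(congr1 (fun r : {poly A} => r`_0)): (e); rewrite coefMX coefMC coefD coefMX coefC add0r.
    by move/esym/eqP; rewrite mulf_eq0 (negbTE p0) orbF => /eqP.
  by exists c; apply: (@mulIf _ 'X); rewrite ?polyX_eq0 // e b0 polyC0 addr0 mulrAC.
have sz g' c : g' * 'X + c%:P != 0 -> (size g' < size (g' * 'X + c%:P)%R)%N.
  by move=> nz; rewrite size_MXaddC; case: ifP => // /andP[/eqP g0 /eqP c0]; rewrite g0 c0 mul0r add0r eqxx in nz.
have step g' c h' : divides p c -> (g' * 'X + c%:P) != 0 ->
    (size (g' * 'X + c%:P)%R + size h' <= n)%N ->
    divides p%:P ((g' * 'X + c%:P) * h') -> divides p%:P (g' * 'X + c%:P) \/ divides p%:P h'.
  move=> /divC pc nz le d; have : divides p%:P (g' * h').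
    apply: divMX; apply: divides_addl (divides_mulr h' pc) _.
    by rewrite mulrAC -mulrDl.
  case/IH => [|dg|]; [|left|by right]; last by apply: dividesD => //; exact: divides_mulr.
  by apply: leq_trans le; rewrite ltn_add2r sz.
have [->|g0] := eqVneq g 0; first by move=> *; left; exists 0; rewrite mul0r.
have [->|h0] := eqVneq h 0; first by move=> *; right; exists 0; rewrite mul0r.
move: g0 h0; elim/poly_ind: g => [|g' a _]; first by rewrite eqxx.
elim/poly_ind: h => [|h' b _]; first by rewrite eqxx.
move=> g0 h0; rewrite ltnS => le d.
have /pp : divides p (a * b).
  by move/div0: (d); rewrite coef0M !coefD !coefMX !coefC /= !add0r.
case=> [pa|pb]; first exact: step.
have [||dh|dg] := @step h' b (g' * 'X + a%:P) pb h0; first by rewrite addnC.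
- by rewrite mulrC.
- by right.
by left.
Qed.

(** Each prime of [c] divides [g] or [h] and is cancelled there. The sizes are recorded in order to
    recognise later which factor is a unit. *)
Lemma prime_prod_cancel c q g h :
  prime_prod c -> c%:P * q = g * h ->
  exists g' h', [/\ q = g' * h', size g' = size g & size h' = size h].
Proof.
move=> cp; elim: cp q g h => [u uu|p a pp pa IH] q g h e.
  exists (u^-1%:P * g), h; split=> //; first by rewrite -mulrA -e mulrA -polyCM mulVr // mul1r.
  by rewrite mul_polyC size_scale // invr_eq0; apply: contraTneq uu => ->; rewrite unitr0.
have [p0 _ _] := pp.
have szp k : size (k * p%:P) = size k by rewrite mulrC mul_polyC size_scale.
have pP0 : p%:P != 0 by rewrite polyC_eq0.
have [_ _ ppP] := prime_polyC pp.
have /ppP : divides p%:P (g * h) by exists (a%:P * q); rewrite -e polyCM; ring.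
case=> -[k kE]; move: e; rewrite kE polyCM szp.
  have -> : p%:P * a%:P * q = p%:P * (a%:P * q) by ring.
  have -> : k * p%:P * h = p%:P * (k * h) by ring.
  by move/(mulfI pP0)/IH.
have -> : p%:P * a%:P * q = p%:P * (a%:P * q) by rewrite mulrA.
have -> : g * (k * p%:P) = p%:P * (g * k) by ring.
by move/(mulfI pP0)/IH.
Qed.

(** No prime of [c] divides the primitive [q], so each one divides the cofactor [g] and cancels. *)
Lemma prime_prod_cancel_primitive c q g h :
  (forall p, prime_elt p -> ~ divides p%:P q) ->
  prime_prod c -> c%:P * h = g * q -> divides q h.
Proof.
move=> qprim cp; elim: cp h g => [u uu|p a pp pa IH] h g e.
  by exists (u^-1%:P * g); rewrite -mulrA -e mulrA -polyCM mulVr // mul1r.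
have [p0 _ _] := pp; have pP0 : p%:P != 0 by rewrite polyC_eq0.
have [_ _ ppP] := prime_polyC pp.
have /ppP : divides p%:P (g * q).
  by exists (a%:P * h); rewrite -e polyCM -mulrA mulrC.
case=> [[k kE]|/qprim//]; apply: (IH _ k); apply: (mulfI pP0).
by rewrite mulrA -polyCM e kE mulrA [p%:P * k]mulrC.
Qed.

(** A constant is handled in [A]. A nonconstant [q] is primitive, and its gcd with [g] over the
    fractions is either trivial, so that [q] divides [h], or associated to [q], so that [q] divides
    [g]. *)
Lemma irreducible_poly_prime q :
  (forall a : A, a != 0 -> prime_prod a) -> irreducible_elt q -> prime_elt q.
Proof.
move=> factA [q0 qu qirr]; have [szq|szq] := leqP (size q) 1.
  have qE := size1_polyC szq; rewrite qE in q0 qu qirr *.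
  move: (q`_0) q0 qu qirr => c; rewrite polyC_eq0 => c0.
  have unitC (x : A) : (x%:P \is a GRing.unit) = (x \is a GRing.unit).
    by rewrite poly_unitE coefC size_polyC; have [->|] := eqVneq x 0; rewrite ?unitr0.
  rewrite unitC => cu cirr; apply: prime_polyC.
  apply: irreducible_prime_of_prod (factA _ c0); split=> // a b cE.
  by rewrite -!unitC; apply: cirr; rewrite cE polyCM.
have nunit g : (1 < size g)%N -> g \isn't a GRing.unit.
  by rewrite poly_unitE => /gtn_eqF ->.
have qprim p : prime_elt p -> ~ divides p%:P q.
  move=> pp [c qE]; have [_ /negP[]] := prime_polyC pp.
  have [cu|//] := qirr _ _ qE.
  move: szq; rewrite qE mulrC mul_polyC size_scale; last by case: pp.
  by move/nunit; rewrite cu.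
(* [%|] is divisibility up to a nonzero scalar of [A]; primitivity of [q] removes the scalar. *)
have pseudo h : q %| h -> divides q h.
  by move=> /Pdiv.Idomain.dvdpP[[c t] /= c0 e]; apply: prime_prod_cancel_primitive (factA _ c0) _ => //; rewrite mul_polyC e.
split=> // g h [k e].
have dgh : q %| g * h by rewrite e dvdp_mulIr.
case cop : (coprimep q g); first by right; apply: pseudo; rewrite -(Gauss_dvdpr _ cop).
left; apply: pseudo.
have /Pdiv.Idomain.dvdpP[[c t] /= c0] := dvdp_gcdl q g.
have d0 : gcdp q g != 0 by rewrite gcdp_eq0 (negbTE q0).
have szd : (1 < size (gcdp q g))%N.
  by move: cop; rewrite coprimep_def ltn_neqAle eq_sym => ->; rewrite size_poly_gt0.
rewrite -mul_polyC => e'.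
have [t' [d' [qE szt szd']]] := prime_prod_cancel (factA _ c0) e'.
have szt1 : size t = 1.
  rewrite -szt; case: (qirr _ _ qE) => [|]; first by rewrite poly_unitE => /andP[/eqP].
  by move=> d'u; move: szd; rewrite -szd' => /nunit; rewrite d'u.
have /eqp_dvdl -> : q %= gcdp q g; last exact: dvdp_gcdr.
have tE := size1_polyC (eq_leq szt1).
apply/eqpP; have t0 : t`_0 != 0 by rewrite -polyC_eq0 -tE -size_poly_eq0 szt1.
by exists (c, t`_0); rewrite ?c0 //= -!mul_polyC e' {1}tE.
Qed.

End PolyPrime.

(** * Factoriality of multivariate polynomials over a field *)

Section MpolyFactorial.
Variable K : fieldType.

Section Muni.
Variable n : nat.
Local Notation A := {mpoly K[n]}.
Local Notation widen := (widen_ord (leqnSn n)).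

Let eval_last (q : {poly A}) : {mpoly K[n.+1]} := (map_poly (@mwiden n K) q).['X_ord_max].

Let muniX (m : 'X_{1..n.+1}) :
  muni 'X_[K, m] = 'X_[[multinom (m (widen i)) | i < n]] *: 'X^(m ord_max).
Proof. by rewrite muniE msuppX big_seq1 mcoeffX eqxx scale1r. Qed.

Let muni_widen (a : A) : muni (mwiden a) = a%:P.
Proof.
have -> : mwiden a = \sum_(m <- msupp a) a@_m *: 'X_[mnmwiden m].
  by rewrite {1}[a]mpolyE raddf_sum /=; apply: eq_bigr => m _; rewrite mwidenZ mwidenX.
rewrite [in RHS](mpolyE a) !raddf_sum /=; apply: eq_bigr => m _.
rewrite muniZ muniX mnmwiden_ordmax expr0 alg_polyC scale_polyC mul_mpolyC.
congr (_ *: 'X_[_])%:P; apply/mnmP => i; by rewrite mnmE mnmwiden_widen.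
Qed.

Let muni_eval q : muni (eval_last q) = q.
Proof.
elim/poly_ind: q => [|q a IH]; first by rewrite /eval_last rmorph0 horner0 muni0.
rewrite /eval_last rmorphD rmorphM /= map_polyX map_polyC hornerMXaddC /=.
rewrite muniD muniM IH muni_widen muniX mnmE eqxx expr1.
rewrite (_ : [multinom _ | _ < n] = 0%MM) ?mpolyX0 ?scale1r //.
apply/mnmP => i; rewrite !mnmE; apply/eqP; rewrite eqb0 -val_eqE /=.
by rewrite neq_ltn ltn_ord orbT.
Qed.

Let eval_muni p : eval_last (muni p) = p.
Proof.
rewrite {2}[p]mpolyE muniE /eval_last !raddf_sum horner_sum; apply: eq_bigr => m _ /=.
rewrite map_polyZ /= hornerZ map_polyXn hornerXn mwidenZ -scalerAl mwidenX mpolyXn -mpolyXD.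
congr (_ *: 'X_[_]); apply/mnmP => i; rewrite mnmDE mulmnE mnmE.
case: (unliftP ord_max i) => [j|] ->.
  rewrite (_ : lift _ _ = widen j); last by apply: val_inj; rewrite /= /bump leqNgt ltn_ord.
  by rewrite mnmwiden_widen mnmE -val_eqE /= gtn_eqF ?ltn_ord // addn0.
by rewrite mnmwiden_ordmax eqxx mul1n.
Qed.

Lemma mpolyS_poly_iso :
  exists (mu : {mpoly K[n.+1]} -> {poly {mpoly K[n]}}) (inv : {poly {mpoly K[n]}} -> {mpoly K[n.+1]}),
    [/\ cancel mu inv, cancel inv mu, {morph mu : a b / a * b}, mu 1 = 1 & mu 0 = 0].
Proof.
exists (@muni n K), eval_last; split=> //; [exact: muniM | exact: muni1 | exact: muni0].
Qed.

End Muni.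

Lemma mpoly_unitE n (p : {mpoly K[n]}) : (p \is a GRing.unit) = (msize p == 1%N).
Proof.
apply/idP/msize_poly1P => [/andP[/eqP pE pu]|[c c0 ->]].
  by exists p@_0; rewrite // -unitfE.
apply/unitrP; exists (c^-1)%:MP; rewrite -!mpolyCM mulVf // mulfV //.
Qed.

Lemma msize_gt1 n (p : {mpoly K[n]}) :
  p != 0 -> p \isn't a GRing.unit -> (1 < msize p)%N.
Proof.
by move=> p0; rewrite mpoly_unitE ltn_neqAle eq_sym => ->; rewrite lt0n msize_poly_eq0.
Qed.

(* [msizeM] at the ring structure that elaboration infers from a field. *)
Lemma msizeMf n (p q : {mpoly K[n]}) :
  p != 0 -> q != 0 -> msize (p * q) = (msize p + msize q).-1.
Proof. exact: msizeM. Qed.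

(** A reducible element splits into nonunits of smaller [msize]; the hypothesis makes the
    irreducible factors prime. *)
Lemma irreducible_factorization n (p : {mpoly K[n]}) :
  (forall q : {mpoly K[n]}, irreducible_elt q -> prime_elt q) ->
  p != 0 -> prime_prod p.
Proof.
move=> irrP; have [m] := ubnP (msize p); elim: m p => // m IH p; rewrite ltnS => szp p0.
have [pu|pu] := boolP (p \is a GRing.unit); first exact: prime_prod_unit.
have [pirr|pred] := classic (irreducible_elt p).
  by rewrite -[p]mulr1; apply: prime_prod_mul (irrP _ pirr) _; apply: prime_prod_unit; rewrite unitr1.
have [a [b [pE au bu]]] : exists a b, [/\ p = a * b, a \isn't a GRing.unit & b \isn't a GRing.unit].
  apply: NNPP => H; apply: pred; split=> // a b pE; apply: NNPP => /not_or_and[/negP au /negP bu].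
  by apply: H; exists a, b.
have [a0 b0] : a != 0 /\ b != 0 by apply/andP; rewrite -negb_or -mulf_eq0 -pE.
have sza := msize_gt1 a0 au; have szb := msize_gt1 b0 bu.
rewrite pE msizeMf // in szp; rewrite pE; apply: prime_prodM; apply: IH => //; lia.
Qed.

(** Induction on the number of variables: with none, nonzero elements are units; the step applies
    Gauss's lemma to polynomials in the last variable. *)
Lemma irreducible_mpoly_prime n (p : {mpoly K[n]}) : irreducible_elt p -> prime_elt p.
Proof.
elim: n p => [|n IH] p pirr.
  have [p0 /negP[]] := pirr; rewrite mpoly_unitE eqn_leq lt0n msize_poly_eq0 p0 andbT.
  rewrite msizeE; apply/bigmax_leqP_seq => m _ _.
  by rewrite mdegE big_ord0.
have [mu [inv [muK invK muM mu1 mu0]]] := mpolyS_poly_iso n.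
have mu_inj := can_inj muK.
have unit_mu q : (mu q \is a GRing.unit) = (q \is a GRing.unit).
  apply/unitrP/unitrP => -[r [rq qr]]; last by exists (mu r); rewrite -!muM rq qr.
  by exists (inv r); split; apply: mu_inj; rewrite muM invK mu1.
have mu_eq0 q : (mu q == 0) = (q == 0) by rewrite -(inj_eq mu_inj) mu0.
have [p0 pu pI] := pirr.
have [_ _ pp] : prime_elt (mu p).
  apply: irreducible_poly_prime; first by move=> a; apply: irreducible_factorization.
  split; rewrite ?mu_eq0 ?unit_mu // => a b e.
  have := pI (inv a) (inv b); rewrite -!unit_mu !invK; apply.
  by apply: mu_inj; rewrite muM !invK.
split=> // a b [c e]; have /pp : divides (mu p) (mu a * mu b).
  by exists (mu c); rewrite -!muM e.
by case=> -[k kE]; [left|right]; exists (inv k); apply: mu_inj; rewrite muM invK.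
Qed.

Lemma mpoly_prime_prod n (p : {mpoly K[n]}) : p != 0 -> prime_prod p.
Proof. by apply: irreducible_factorization; exact: irreducible_mpoly_prime. Qed.

(** Common primes are moved into [g] one by one. Once none remains, each prime of [a'] must divide
    [c]; coprimality is stated in this form of Euclid's lemma. *)
Lemma mpoly_coprime_parts n (a b : {mpoly K[n]}) : a != 0 ->
  exists g a' b' : {mpoly K[n]}, [/\ a = g * a', b = g * b'
    & forall c : {mpoly K[n]}, divides a' (c * b') -> divides a' c].
Proof.
have [m] := ubnP (msize a); elim: m a b => // m IH a b; rewrite ltnS => sza a0.
have [[p [pp [a' aE] [b' bE]]]|nop] :=
    classic (exists p, [/\ prime_elt p, divides p a & divides p b]).
  have [p0 pu _] := pp; have a'0 : a' != 0 by apply: contraNneq a0 => e; rewrite aE e mul0r.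
  have [|g [a2 [b2 [a'E b'E cop]]]] := IH a' b' _ a'0.
    by have := msize_gt1 p0 pu; move: sza; rewrite aE msizeMf //; lia.
  by exists (g * p), a2, b2; split=> //; rewrite ?aE ?bE ?a'E ?b'E; ring.
exists 1, a, b; split; rewrite ?mul1r // => c.
have : forall p, prime_elt p -> divides p a -> ~ divides p b.
  by move=> p pp pa pb; apply: nop; exists p.
elim: (mpoly_prime_prod a0) c => [u uu|p a1 pp _ IHa] c {}nop; first by move=> _; exact: divides_unit.
have [p0 _ ppP] := pp; case=> k e.
have [[c' cE]|/nop[]//] : divides p c \/ divides p b.
- by apply: ppP; exists (k * a1); rewrite e; ring.
- have [||k' c'E] := IHa c'.
  + by move=> q qp qa; apply: nop => //; exact: divides_mull.
  + by exists k; apply: (mulfI p0); transitivity (c * b); [rewrite cE; ring | rewrite e; ring].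
  by rewrite cE c'E; exists k'; ring.
by exists a1; ring.
Qed.

End MpolyFactorial.

(** * Homogeneous polynomials and linear forms *)

Section Homogeneous.
Variables (n : nat) (K : fieldType).
Local Notation S := {mpoly K[n]}.
Implicit Types (p q : S) (i j : 'I_n).

(** Any other pair of monomials with this product has a member below [mlast p] or [mlast q], hence a
    zero coefficient. *)
Lemma mlastcM p q : (p * q)@_(mlast p + mlast q) = p@_(mlast p) * q@_(mlast q).
Proof.
have [->|p0] := eqVneq p 0; first by rewrite !mul0r !mcoeff0 mul0r.
have [->|q0] := eqVneq q 0; first by rewrite !mulr0 !mcoeff0 mulr0.
rewrite mcoeffM.
have lt1 : (mdeg (mlast p) < (mdeg (mlast p + mlast q)).+1)%N by rewrite mdegD; lia.
have lt2 : (mdeg (mlast q) < (mdeg (mlast p + mlast q)).+1)%N by rewrite mdegD; lia.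
rewrite (bigD1 (BMultinom lt1, BMultinom lt2)) //= big1 ?addr0 // => -[[a la] [b lb]] /= /andP[/eqP e ne].
have [lt|le] := ltP a (mlast p); first by rewrite mcoeff_lt_mlast ?mul0r.
have [lt'|le'] := ltP b (mlast q); first by rewrite (mcoeff_lt_mlast lt') mulr0.
move: le ne; rewrite le_eqVlt => /predU1P[aE|/ltmc_le_add/(_ le')]; last first.
  by move=> lts; move: (lts); rewrite [X in (X < _)%O]e ltxx.
move: (e) => /eqP; rewrite -{1}aE eqm_add2l => /eqP bE /eqP[].
by apply/eqP; rewrite xpair_eqE -!val_eqE /= aE bE !eqxx.
Qed.

(** Highest and lowest degrees both add under products; they agree for the product, hence for each
    factor. *)
Lemma dhomog_factors p q d : p * q != 0 -> p * q \is d.-homog ->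
  exists k e, [/\ p \is k.-homog, q \is e.-homog & (k + e)%N = d].
Proof.
rewrite mulf_eq0 negb_or => /andP[p0 q0] /dhomogP hpq.
have hi : (mdeg (mlead p) + mdeg (mlead q))%N = d.
  by rewrite -mdegD -mleadM //; apply: hpq; rewrite mlead_supp ?mulf_neq0.
have lo : (mdeg (mlast p) + mdeg (mlast q))%N = d.
  rewrite -mdegD; apply: hpq; rewrite mcoeff_msupp mlastcM mulf_neq0 // -mcoeff_msupp;
  exact: mlast_supp.
have ext (r : S) m : m \in msupp r -> (mdeg (mlast r) <= mdeg m <= mdeg (mlead r))%N.
  by move=> mr; rewrite !lemc_mdeg //; [exact: msupp_le_mlead|exact: mlast_lemc].
have lep : (mdeg (mlast p) <= mdeg (mlead p))%N by have /andP[] := ext p _ (mlead_supp p0).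
have leq : (mdeg (mlast q) <= mdeg (mlead q))%N by have /andP[] := ext q _ (mlead_supp q0).
have [ep eq] : mdeg (mlast p) = mdeg (mlead p) /\ mdeg (mlast q) = mdeg (mlead q) by lia.
exists (mdeg (mlead p)), (mdeg (mlead q)).
by split=> //; apply/dhomogP => m /ext; rewrite ?ep ?eq => /anti_leq.
Qed.

Lemma dhomog_cofactor p q k d : p != 0 -> p \is k.-homog -> (k <= d)%N -> p * q \is d.-homog ->
  q \is (d - k).-homog.
Proof.
move=> p0 hp kd hpq; have [->|q0] := eqVneq q 0; first exact: dhomog0.
have [||k' [e [hp' hq <-]]] := @dhomog_factors p q d; rewrite ?mulf_neq0 //.
by rewrite (dhomog_uniq p0 hp hp') addKn.
Qed.

Lemma dhomog_deriv p d i : p \is d.-homog -> p^`M(i) \is d.-1.-homog.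
Proof.
move=> /dhomogP hp; apply/dhomogP => m; rewrite mcoeff_msupp mcoeff_deriv => nz.
have e : mdeg (m + U_(i)) = d.
  by apply: hp; rewrite mcoeff_msupp; apply: contraNneq nz => ->; rewrite mul0rn.
by rewrite -e mdegD mdeg1 addn1.
Qed.

Lemma euler_homog p d : p \is d.-homog -> \sum_i 'X_i * p^`M(i) = d%:R *: p.
Proof.
move=> /dhomogP hp; rewrite [in RHS](mpolyE p) scaler_sumr.
under eq_bigr => i _ do rewrite /mderiv mulr_sumr.
rewrite exchange_big /=; apply: eq_big_seq => m mp; have <- : mdeg m = d := hp m mp.
have H i : 'X_i * (((m i)%:R * p@_m) *: 'X_[m - U_(i)]) = (m i)%:R *: (p@_m *: 'X_[m]).
  (* [m - U_(i)] is truncated, so the case [m i = 0] is settled by the zero coefficient. *)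
  rewrite -scalerAr scalerA; have [->|mi] := posnP (m i); first by rewrite mul0r !scale0r.
  rewrite -mpolyXD addmC submK //; apply/mnm_lepP => j; rewrite mnm1E.
  by case: eqP => // <-.
by rewrite (eq_bigr _ (fun i _ => H i)) -scaler_suml -natr_sum mdegE.
Qed.

Lemma msize_deriv p i : p != 0 -> (msize p^`M(i) < msize p)%N.
Proof.
move=> p0; have := p0; rewrite -msize_poly_eq0 -lt0n; case sz: (msize p) => [//|s] _.
rewrite ltnS msizeE; apply/bigmax_leqP_seq => m mp _.
have : (m + U_(i))%MM \in msupp p.
  by move: mp; rewrite !mcoeff_msupp mcoeff_deriv; apply: contraNneq => ->; rewrite mul0rn.
by move/msize_mdeg_lt; rewrite sz mdegD mdeg1 addn1.
Qed.

Lemma deriv_ndivides p i : p^`M(i) != 0 -> ~ divides p p^`M(i).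
Proof.
move=> pi0 [r0 r0E]; have [r piE] : exists r : S, p^`M(i) = r * p by exists r0.
have p0 : p != 0 by apply: contraNneq pi0 => ->; rewrite mderiv0.
have r_neq0 : r != 0 by apply: contraNneq pi0 => r_eq0; rewrite piE r_eq0 mul0r.
have := msize_deriv i p0; rewrite piE msizeMf //.
have : (0 < msize r)%N by rewrite lt0n msize_poly_eq0.
lia.
Qed.

(** Differentiating along a variable of the leading monomial multiplies its coefficient by a
    positive exponent, which is nonzero in [K]. *)
Lemma deriv_neq0 p : (forall k, k.+1%:R != 0 :> K) -> (1 < msize p)%N -> exists i, p^`M(i) != 0.
Proof.
move=> char0 szp; have p0 : p != 0 by rewrite -msize_poly_eq0; lia.
have mp : (0 < mdeg (mlead p))%N by have := mlead_deg p0; lia.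
have [i mi] : exists i, (0 < mlead p i)%N.
  apply/existsP; apply: contraLR mp; rewrite negb_exists -eqn0Ngt mdegE => /forallP H.
  by rewrite big1 // => i _; apply/eqP; have := H i; rewrite -eqn0Ngt.
exists i; apply/negP => /eqP /(congr1 (mcoeff (mlead p - U_(i)))).
rewrite mcoeff0 mcoeff_deriv submK; last first.
  by apply/mnm_lepP => j; rewrite mnm1E; case: eqP => // <-.
by move/eqP; rewrite -mulr_natr mulf_eq0 (negbTE (char0 _)) orbF mleadc_eq0 (negbTE p0).
Qed.

Lemma dhomog_bigprod (I : finType) (F : I -> S) (e : I -> nat) :
  (forall t, F t \is (e t).-homog) -> \prod_t F t \is (\sum_t e t).-homog.
Proof. by move=> H; elim/big_rec2: _ => [|i x y _ hy]; [exact: dhomog1|exact: dhomogM]. Qed.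

End Homogeneous.

(* [pi] solves [l = 0] for one of the variables, so that it computes in the quotient by [l]
   while staying inside the polynomial ring. *)
Lemma linear_form_retraction n (K : fieldType) (l : {mpoly K[n]}) : l != 0 -> l \is 1.-homog ->
  exists pi : {rmorphism {mpoly K[n]} -> {mpoly K[n]}},
    [/\ pi l = 0, forall p, divides l (p - pi p)
      & forall p d, p \is d.-homog -> pi p \is d.-homog].
Proof.
move=> l0 hl; have lE : l = \sum_i l^`M(i) * 'X_i.
  by rewrite -[LHS]scale1r -(euler_homog hl); apply: eq_bigr => i _; rewrite mulrC.
have [k lk] : exists k, l^`M(k) != 0.
  apply: NNPP => H; move/eqP: l0; apply; rewrite lE big1 // => i _.
  by apply/eqP; rewrite mulf_eq0; apply/orP; left; apply/negPn/negP => li; apply: H; exists i.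
have lC i : l^`M(i) = (l^`M(i)@_0)%:MP.
  apply: msize1_polyC; rewrite msizeE; apply/bigmax_leqP_seq => m ms _.
  by have /dhomogP -> := dhomog_deriv i hl.
set c := (l^`M(k))@_0; have c0 : c != 0 by apply: contraNneq lk => e; rewrite lC -/c e mpolyC0.
(* The substitution sends ['X_k] to ['X_k - c^-1 *: l], a form free of ['X_k], and fixes the other
   variables. *)
pose lq := [tuple 'X_i - (i == k)%:R *: (c^-1 *: l) | i < n].
have lqE i : tnth lq i = 'X_i - (i == k)%:R *: (c^-1 *: l) by rewrite tnth_mktuple.
have lqX i : 'X_i \mPo lq = tnth lq i by rewrite comp_mpolyXU -tnth_nth.
exists (comp_mpoly lq : {rmorphism _ -> _}); split=> /=.
- rewrite {1}lE rmorph_sum /=.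
  under eq_bigr => i _ do rewrite rmorphM /= lqX lqE lC comp_mpolyC mulrBr -lC.
  rewrite sumrB -lE (bigD1 k) //= big1 => [|i /negbTE ->]; last by rewrite scale0r mulr0.
  by rewrite eqxx scale1r addr0 lC -/c mul_mpolyC scalerA mulfV // scale1r subrr.
- move=> p; rewrite {1}[p]mpolyE comp_mpolyEX -sumrB.
  apply: big_ind => [|x y|m _]; first by exists 0; rewrite mul0r.
    exact: dividesD.
  rewrite -scalerBr -mul_mpolyC; apply: divides_mull.
  rewrite comp_mpolyX mpolyXE_id.
  elim/big_rec2: _ => [|i y1 y2 _ IH]; first by rewrite subrr; exists 0; rewrite mul0r.
  have Hp e : divides l ('X_i ^+ e - tnth lq i ^+ e).
    rewrite subrXX; apply: divides_mulr; rewrite lqE opprB addrC subrK.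
    by rewrite -!mul_mpolyC; do 2 apply: divides_mull; exists 1; rewrite mul1r.
  rewrite (_ : _ - _ = ('X_i ^+ m i - tnth lq i ^+ m i) * y2 + tnth lq i ^+ m i * (y2 - y1)); last by ring.
  by apply: dividesD; [exact: divides_mulr|exact: divides_mull].
move=> p d /dhomogP hp; rewrite comp_mpolyE big_seq; apply: rpred_sum => m mp; have <- : mdeg m = d := hp m mp.
apply: rpredZ; rewrite mdegE; apply: dhomog_bigprod => i; rewrite -[X in X.-homog]mul1n.
apply: dhomogMn; rewrite lqE; apply: rpredB; first by rewrite dhomogX; apply/eqP; exact: mdeg1.
by do 2 apply: rpredZ.
Qed.

(** A prime of [s] not dividing [x] would divide every [F i]; so it divides [x], and it cancels from
    both sides. *)
Lemma divides_of_coprime_family n (K : fieldType) (I : Type) (F : I -> {mpoly K[n]}) s x :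
  (forall p, prime_elt p -> ~ forall i, divides p (F i)) ->
  s != 0 -> (forall i, divides s (x * F i)) -> divides s x.
Proof.
move=> cop s0; elim: (mpoly_prime_prod s0) x => [u uu|p a pp _ IH] x H; first exact: divides_unit.
have [p0 _ ppP] := pp.
have [y xE] : divides p x.
  apply: NNPP => npx; apply: (cop p pp) => i.
  have [k e] := H i; have [//|//] : divides p x \/ divides p (F i).
  by apply: ppP; exists (k * a); rewrite e; ring.
have [|z yE] := IH y; last by exists z; rewrite xE yE; ring.
move=> i; have [k e] := H i; exists k; apply: (mulfI p0).
by transitivity (x * F i); [rewrite xE; ring | rewrite e; ring].
Qed.

(** * Relations between two forms modulo a linear form *)

Section Relations.
Variables (n : nat) (K : fieldType).
Local Notation S := {mpoly K[n]}.
Implicit Types (l p q alpha beta : S).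

(** The retraction [pi] takes values in a domain and its kernel is the ideal of [l]. *)
Lemma linear_form_prime l p q : l != 0 -> l \is 1.-homog ->
  divides l (p * q) -> divides l p \/ divides l q.
Proof.
move=> l0 hl [c e]; have [pi [pil mod_l _]] := linear_form_retraction l0 hl.
have : pi p * pi q = 0 by rewrite -rmorphM e rmorphM /= pil mulr0.
move/eqP; rewrite mulf_eq0 => /orP[] /eqP pi0; [left; move: (mod_l p)|right; move: (mod_l q)];
by rewrite pi0 subr0.
Qed.

(** A coefficient, on a basis vector of degree [d], of an element of degree [e]. Only [p = 0] is
    left when [e < d], and the sum avoids truncated subtraction. *)
Definition homog_above d e p : Prop := p = 0 \/ exists2 k, p \is k.-homog & (k + d)%N = e.

Lemma homog_aboveM d e p q : homog_above d e p -> q \is d.-homog -> p * q \is e.-homog.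
Proof. by case=> [->|[k hp <-]] hq; [rewrite mul0r dhomog0|exact: dhomogM]. Qed.

(* Homogeneous generators (a, b) of the module [a * alpha + b * beta \in (l)], the basis
   vectors having degrees [d1] and [d2]; [h] is the quotient by [l]. *)
Definition relation_system d1 d2 l alpha beta m (deg : 'I_m -> nat) (a b h : 'I_m -> S) : Prop :=
  [/\ forall k, a k * alpha + b k * beta = l * h k,
      forall k, (a k != 0) || (b k != 0),
      forall k, homog_above d1 (deg k) (a k) /\ homog_above d2 (deg k) (b k)
    & forall x y z, x * alpha + y * beta = l * z -> exists c : 'I_m -> S,
        x = \sum_k c k * a k /\ y = \sum_k c k * b k].

Lemma relation_system_exists d1 d2 l alpha beta :
  l != 0 -> l \is 1.-homog -> alpha \is d1.-homog -> beta \is d2.-homog -> (d1 <= d2)%N ->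
  (exists (deg : 'I_2 -> nat) a b h, relation_system d1 d2 l alpha beta deg a b h) \/
  (exists (e : nat) a b h, (d2 < e)%N /\
     relation_system d1 d2 l alpha beta (fun k : 'I_3 => nth 0 [:: d1.+1; d2.+1; e] k)%N a b h).
Proof.
move=> l0 hl ha hb d12; have [pi [pil mod_l pih]] := linear_form_retraction l0 hl.
have pi_rel x y z : x * alpha + y * beta = l * z -> pi x * pi alpha + pi y * pi beta = 0.
  by rewrite -!rmorphM -rmorphD => ->; rewrite rmorphM /= pil mul0r.
have pi_ker p : pi p = 0 -> divides l p by move=> e; have := mod_l p; rewrite e subr0.
have sum2 (F : 'I_2 -> S) : \sum_k F k = F ord0 + F (lift ord0 ord0).
  by rewrite !big_ord_recl big_ord0 addr0.
have sum3 (F : 'I_3 -> S) :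
    \sum_k F k = F ord0 + F (lift ord0 ord0) + F (lift ord0 (lift ord0 ord0)).
  by rewrite !big_ord_recl big_ord0 addr0 addrA.
have homog_aboveS d p : p \is 1.-homog -> homog_above d d.+1 p by right; exists 1%N.
have homog_above1 d : homog_above d d 1 by right; exists 0%N => //; exact: dhomog1.
have homog_above0 d e : homog_above d e 0 by left.
have [pia|pia] := eqVneq (pi alpha) 0.
  (* When [l] divides [alpha], the pair [(1, 0)] is a relation; the other generator is [(0, 1)] or
     [(0, l)], according to whether [l] divides [beta]. *)
  left; have [u uE] := pi_ker _ pia; have [pib|pib] := eqVneq (pi beta) 0.
    have [v vE] := pi_ker _ pib.
    exists (fun k => nth 0%N [:: d1; d2] k), (fun k => nth 0 [:: 1; 0] k),
      (fun k => nth 0 [:: 0; 1] k), (fun k => nth 0 [:: u; v] k); split.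
    - by case=> [[|[|//]] lt] /=; rewrite ?uE ?vE; ring.
    - by case=> [[|[|//]] lt] /=; rewrite oner_neq0 ?orbT.
    - by case=> [[|[|//]] lt] /=; split.
    move=> x y z _; exists (fun k => nth 0 [:: x; y] k).
    by rewrite !sum2 /= !mulr0 !mulr1 addr0 add0r.
  exists (fun k => nth 0%N [:: d1; d2.+1] k), (fun k => nth 0 [:: 1; 0] k),
    (fun k => nth 0 [:: 0; l] k), (fun k => nth 0 [:: u; beta] k); split.
  - by case=> [[|[|//]] lt] /=; rewrite ?uE; ring.
  - by case=> [[|[|//]] lt] /=; rewrite ?oner_neq0 ?l0 ?orbT.
  - by case=> [[|[|//]] lt] /=; split; auto.
  move=> x y z /pi_rel; rewrite pia mulr0 add0r => /eqP; rewrite mulf_eq0 (negbTE pib) orbF.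
  move=> /eqP/pi_ker[v ->]; exists (fun k => nth 0 [:: x; v] k).
  by rewrite !sum2 /= !mulr0 mulr1 addr0 add0r.
have [g [A [B [aE bE cop]]]] := mpoly_coprime_parts (pi beta) pia.
have [g0 A0] : g != 0 /\ A != 0 by apply/andP; rewrite -negb_or -mulf_eq0 -aE.
have [q [p [hg hA pq]]] : exists q p : nat, [/\ g \is q.-homog, A \is p.-homog & (q + p)%N = d1].
  by apply: dhomog_factors; rewrite -aE //; exact: pih.
have hB : B \is (d2 - q).-homog.
  by apply: dhomog_cofactor g0 hg _ _; [lia|rewrite -bE; exact: pih].
have [s sE] : divides l (alpha - g * A) by rewrite -aE.
have [t tE] : divides l (beta - g * B) by rewrite -bE.
have rel3 : B * alpha + - A * beta = l * (B * s - A * t).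
  transitivity (B * (alpha - g * A) - A * (beta - g * B)); first by ring.
  by rewrite sE tE; ring.
(* The degree of [B] is [d2 - q] with [q <= d1 <= d2], so nothing is truncated and both coordinates
   give [p + d2]. *)
have homB : homog_above d1 (p + d2) B by right; exists (d2 - q)%N; [|clear -pq d12; lia].
have homA : homog_above d2 (p + d2) (- A) by right; exists p; rewrite ?rpredN.
(* Modulo [l], after cancelling [g], a relation reads [x * A + y * B = 0], so by coprimality
   [(x, y)] is a multiple of [(- B, A)]. *)
have rel_gen x y z : x * alpha + y * beta = l * z ->
    exists k u v, x = u * l - k * B /\ y = v * l + k * A.
  move=> /pi_rel e.
  have e' : pi x * A + pi y * B = 0.
    by apply: (mulfI g0); rewrite mulr0 -[RHS]e aE bE; ring.
  have [|k kE] := cop (pi y).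
    by exists (- pi x); apply/eqP; rewrite -subr_eq0; apply/eqP; rewrite -[RHS]e'; ring.
  have piy : pi x = - (k * B).
    by apply: (mulIf A0); apply/eqP; rewrite -subr_eq0; apply/eqP; rewrite -[RHS]e' kE; ring.
  have [u uE] := mod_l x; have [v vE] := mod_l y.
  exists k, u, v; split; first by rewrite -uE piy; ring.
  by rewrite -vE kE; ring.
have [p0|p0] := posnP p; [left|right].
  have [c c0 AE] : exists2 c, c != 0 & A = c%:MP.
    apply/msize_poly1P; rewrite -(mlead_deg A0).
    by have /dhomogP/(_ _ (mlead_supp A0)) := hA; rewrite p0 => /= ->.
  have cV : c%:MP * (c^-1)%:MP = 1 :> S by rewrite -mpolyCM mulfV.
  exists (fun k => nth 0%N [:: d1.+1; d2] k), (fun k => nth 0 [:: l; B] k),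
    (fun k => nth 0 [:: 0; - A] k), (fun k => nth 0 [:: alpha; B * s - A * t] k); split.
  - by case=> [[|[|//]] lt] /=; rewrite ?rel3; ring.
  - by case=> [[|[|//]] lt] /=; rewrite ?l0 ?oppr_eq0 ?A0 ?orbT.
  - by case=> [[|[|//]] lt] /=; split; rewrite ?p0 in homA homB *; auto.
  move=> x y z /rel_gen[k [u [v [-> ->]]]].
  (* These coefficients eliminate [(0, l)] by means of [c * (0, l) = B * (l, 0) - l * (B, - A)]. *)
  exists (fun j => nth 0 [:: u + v * B * (c^-1)%:MP; - (k + v * l * (c^-1)%:MP)] j).
  rewrite !sum2 /= AE; split; first by ring.
  transitivity (v * l * (c%:MP * (c^-1)%:MP) + k * c%:MP); last by ring.
  by rewrite cV mulr1.
exists (p + d2)%N, (fun k => nth 0 [:: l; 0; B] k), (fun k => nth 0 [:: 0; l; - A] k),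
  (fun k => nth 0 [:: alpha; beta; B * s - A * t] k); split; first by clear -p0; lia.
split.
- by case=> [[|[|[|//]]] lt] /=; rewrite ?rel3; ring.
- by case=> [[|[|[|//]]] lt] /=; rewrite ?l0 ?oppr_eq0 ?A0 ?orbT.
- by case=> [[|[|[|//]]] lt] /=; split; auto.
move=> x y z /rel_gen[k [u [v [-> ->]]]].
by exists (fun j => nth 0 [:: u; v; - k] j); rewrite !sum3 /=; split; ring.
Qed.

End Relations.

(** * Jacobian syzygies *)

Section Curves.
Variable R : realType.
Local Notation S := {mpoly R[i][3]}.
Implicit Types (f g l p q : S) (u v w : 'I_3 -> S).

Local Notation i0 := (ord0 : 'I_3).
Local Notation i1 := (lift ord0 ord0 : 'I_3).
Local Notation i2 := (lift ord0 (lift ord0 ord0) : 'I_3).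

Lemma sum3 (F : 'I_3 -> S) : \sum_(j < 3) F j = F i0 + F i1 + F i2.
Proof. by rewrite !big_ord_recl big_ord0 addr0 addrA. Qed.

Lemma ord3P (P : 'I_3 -> Prop) : P i0 -> P i1 -> P i2 -> forall j, P j.
Proof.
move=> P0 P1 P2 [[|[|[|//]]] lt].
- by rewrite (_ : Ordinal lt = i0) //; exact: val_inj.
- by rewrite (_ : Ordinal lt = i1) //; exact: val_inj.
by rewrite (_ : Ordinal lt = i2) //; exact: val_inj.
Qed.

Definition cross u v (j : 'I_3) : S :=
  match val j with
  | 0 => u i1 * v i2 - u i2 * v i1
  | 1 => u i2 * v i0 - u i0 * v i2
  | _ => u i0 * v i1 - u i1 * v i0
  end.

Lemma nat_neq0 k : k.+1%:R != 0 :> R[i].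
Proof. by rewrite pnatr_eq0. Qed.

(** Both syzygies are orthogonal to the gradient, so their cross product is parallel to it. *)
Lemma cross_proportional f u v i j : jac_syzygy f u -> jac_syzygy f v ->
  cross u v i * f^`M(j) = cross u v j * f^`M(i).
Proof.
rewrite /jac_syzygy !sum3 => hu hv.
have key (x y t s : S) : x - y = t * (u i0 * f^`M(i0) + u i1 * f^`M(i1) + u i2 * f^`M(i2))
    - s * (v i0 * f^`M(i0) + v i1 * f^`M(i1) + v i2 * f^`M(i2)) -> x = y.
  by rewrite hu hv !mulr0 subr0 => /eqP; rewrite subr_eq0 => /eqP.
have e01 : cross u v i0 * f^`M(i1) = cross u v i1 * f^`M(i0).
  by apply: (key _ _ (v i2) (u i2)); rewrite /cross /=; ring.
have e12 : cross u v i1 * f^`M(i2) = cross u v i2 * f^`M(i1).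
  by apply: (key _ _ (v i0) (u i0)); rewrite /cross /=; ring.
have e20 : cross u v i2 * f^`M(i0) = cross u v i0 * f^`M(i2).
  by apply: (key _ _ (v i1) (u i1)); rewrite /cross /=; ring.
move: i j; apply: ord3P; apply: ord3P; [|exact: e01|exact/esym/e20
  |exact/esym/e01| |exact: e12|exact: e20|exact/esym/e12|]; exact: erefl.
Qed.

Definition vec3 (a b c : S) (j : 'I_3) : S :=
  match val j with 0 => a | 1 => b | _ => c end.

(** The witnesses are the two Koszul syzygies that involve the partial of index [i]. *)
Lemma koszul_pair f i : exists u v, [/\ jac_syzygy f u, jac_syzygy f v
  & forall j, cross u v j = f^`M(i) * f^`M(j)].
Proof.
pose x := f^`M(i0); pose y := f^`M(i1); pose z := f^`M(i2).
move: i; apply: ord3P.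
- exists (vec3 y (- x) 0), (vec3 z 0 (- x)).
  by split; rewrite /jac_syzygy ?sum3 -/x -/y -/z /vec3 /=; [ring|ring|apply: ord3P; rewrite /cross /= -/x -/y -/z; ring].
- exists (vec3 y (- x) 0), (vec3 0 z (- y)).
  by split; rewrite /jac_syzygy ?sum3 -/x -/y -/z /vec3 /=; [ring|ring|apply: ord3P; rewrite /cross /= -/x -/y -/z; ring].
exists (vec3 z 0 (- x)), (vec3 0 z (- y)).
by split; rewrite /jac_syzygy ?sum3 -/x -/y -/z /vec3 /=; [ring|ring|apply: ord3P; rewrite /cross /= -/x -/y -/z; ring].
Qed.

Lemma homog_deriv_neq0 f d : f \is d.-homog -> (0 < d)%N -> f != 0 -> exists j, f^`M(j) != 0.
Proof.
move=> hf d0 f0; apply: deriv_neq0 nat_neq0 _.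
have : mdeg (mlead f) = d by have /dhomogP := hf; apply; exact: mlead_supp.
by move=> e; rewrite -(mlead_deg f0) e.
Qed.

(** With at most one generator all cross products of syzygies vanish, unlike that of a Koszul pair
    at a nonzero partial. *)
Lemma two_le_gens f d n deg gen : f \is d.-homog -> (0 < d)%N -> f != 0 ->
  @homog_gen_system R f n deg gen -> (2 <= n)%N.
Proof.
move=> hf d0 f0 [_ span]; rewrite leqNgt; apply/negP => n1.
have [j fj] := homog_deriv_neq0 hf d0 f0.
have [u [v [su sv uv]]] := koszul_pair f j.
have [a ua] := span u su; have [b vb] := span v sv.
have : cross u v j = 0.
  case: n n1 deg gen span a ua b vb => [|[|//]] _ deg gen _ a ua b vb.
    by move: j {fj uv}; apply: ord3P; rewrite /cross /= !ua !big_ord0; ring.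
  by move: j {fj uv}; apply: ord3P; rewrite /cross /= !ua !vb !big_ord_recl !big_ord0; ring.
by rewrite uv => /eqP; rewrite mulf_eq0 (negbTE fj).
Qed.

(** By Euler's identity a common prime [p] of the partials gives [f = q * p]. By Leibniz [p] divides
    [q] times a nonzero partial of [p], which has smaller degree; so [p] divides [q] and its square
    divides [f]. *)
Lemma reduced_partials_coprime f d p : f \is d.-homog -> (0 < d)%N -> reduced f ->
  prime_elt p -> ~ forall j, divides p (f^`M(j)).
Proof.
move=> hf d0 [f0 sqf] [p0 pu pp] pdiv.
have d0' : d%:R != 0 :> R[i] by rewrite pnatr_eq0 -lt0n.
have [q fE] : divides p f.
  have -> : f = (d%:R^-1)%:MP * \sum_j 'X_j * f^`M(j).
    by rewrite (euler_homog hf) mul_mpolyC scalerA mulVf // scale1r.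
  apply: divides_mull; rewrite sum3.
  by apply: dividesD; [apply: dividesD|]; apply: divides_mull.
have szp := msize_gt1 p0 pu.
have [j pj] := deriv_neq0 nat_neq0 szp.
have : divides p (q * p^`M(j)).
  have := pdiv j; rewrite fE mderivM addrC => h.
  by apply: divides_addl h; exists q^`M(j).
case/pp => [[r qE]|/(deriv_ndivides pj)//].
have e : f = p * p * r by rewrite fE qE; ring.
by have := sqf _ _ e; rewrite leqNgt szp.
Qed.

(* Saito's criterion: the cross product of a basis of syzygies is the gradient up to a constant. *)
Lemma free_degrees f d d1 d2 (r1 r2 : 'I_3 -> S) :
  f \is d.-homog -> (0 < d)%N -> reduced f ->
  homog_triple d1 r1 -> homog_triple d2 r2 -> jac_syzygy f r1 -> jac_syzygy f r2 ->
  (forall v, jac_syzygy f v -> exists a b, forall j, v j = a * r1 j + b * r2 j) ->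
  (d1 + d2)%N = d.-1 /\ exists j, cross r1 r2 j != 0.
Proof.
move=> hf d0 fred h1 h2 s1 s2 span; have [f0 _] := fred.
have [k fk] := homog_deriv_neq0 hf d0 f0.
have cop := reduced_partials_coprime hf d0 fred.
(* Proportionality shows that the [k]-th partial divides this coordinate times every partial, and
   the partials have no common prime. *)
have [c Nk] : divides (f^`M(k)) (cross r1 r2 k).
  apply: (divides_of_coprime_family (F := fun j => f^`M(j))) => // j.
  by rewrite (cross_proportional _ _ s1 s2); exists (cross r1 r2 j).
have N j : cross r1 r2 j = c * f^`M(j).
  apply: (mulIf fk); rewrite (cross_proportional _ _ s1 s2) Nk; ring.
(* Expressed in the basis, a Koszul pair has as cross product a determinant times that of [r1] and
   [r2]; comparing [k]-th coordinates gives the divisibility. *)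
have cdiv i : divides c (f^`M(i)).
  have [u [v [su sv uv]]] := koszul_pair f i.
  have [a [b ua]] := span u su; have [a' [b' vb]] := span v sv.
  exists (a * b' - a' * b); apply: (mulIf fk); rewrite -uv -mulrA -N.
  by move: k {fk Nk}; apply: ord3P; rewrite /cross /= !ua !vb; ring.
have c0 : c != 0.
  by apply: contraNneq fk => c0; have [x ->] := cdiv k; rewrite c0 mulr0.
have cu : c \is a GRing.unit.
  case: (mpoly_prime_prod c0) cdiv => // p a pp _ cdiv; case: (cop p pp) => j.
  by have [x ->] := cdiv j; exists (x * a); ring.
have N0 : cross r1 r2 k != 0 by rewrite N mulf_neq0.
split; last by exists k.
have hN : cross r1 r2 k \is (d1 + d2).-homog.
  have hM i j : r1 i * r2 j \is (d1 + d2).-homog by exact: dhomogM.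
  by move: k {fk Nk N0}; apply: ord3P; rewrite /cross /=; apply: rpredB; exact: hM.
apply: (dhomog_uniq N0 hN); rewrite N.
rewrite mpoly_unitE in cu; have /msize_poly1P[x _ ->] := cu.
by rewrite mul_mpolyC; apply: rpredZ; exact: dhomog_deriv.
Qed.

(** * Syzygies of the union with a line *)

Section AddLine.
Variables (d d1 d2 : nat) (f l : S) (r1 r2 : 'I_3 -> S).
Hypotheses (d_gt0 : (0 < d)%N) (hf : f \is d.-homog) (fred : reduced f).
Hypotheses (l_neq0 : l != 0) (hl : l \is 1.-homog) (ndiv_lf : ~ divides l f).
Hypotheses (h1 : homog_triple d1 r1) (h2 : homog_triple d2 r2).
Hypotheses (s1 : jac_syzygy f r1) (s2 : jac_syzygy f r2).
Hypothesis span : forall v, jac_syzygy f v -> exists a b, forall j, v j = a * r1 j + b * r2 j.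

Definition along_line v : S := \sum_(j < 3) v j * l^`M(j).

Local Notation alpha := (along_line r1).
Local Notation beta := (along_line r2).

Lemma along_line_homog k v : homog_triple k v -> along_line v \is k.-homog.
Proof.
move=> hv; apply: rpred_sum => j _; rewrite -[k]addn0; apply: dhomogM; first exact: hv.
exact: (dhomog_deriv _ hl).
Qed.

(* The syzygy of [f * l] attached to a relation [a * alpha + b * beta = l * h]; the Euler
   multiple is the one that makes it annihilate [f * l] and not only preserve its ideal. *)
Definition lift_syzygy (a b h : S) (j : 'I_3) : S :=
  a * r1 j + b * r2 j - (d.+1%:R^-1)%:MP * h * 'X_j.

Let invd k : (k.+1%:R^-1)%:MP * k.+1%:R = 1 :> S.
Proof. by rewrite -mpolyC_nat -mpolyCM mulVf ?nat_neq0 // mpolyC1. Qed.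

Let euler_f : 'X_i0 * f^`M(i0) + 'X_i1 * f^`M(i1) + 'X_i2 * f^`M(i2) = d%:R * f.
Proof. by have := euler_homog hf; rewrite sum3 -mul_mpolyC mpolyC_nat. Qed.

Let euler_l : 'X_i0 * l^`M(i0) + 'X_i1 * l^`M(i1) + 'X_i2 * l^`M(i2) = l.
Proof. by have := euler_homog hl; rewrite sum3 scale1r. Qed.

Lemma jac_syzygyM v : jac_syzygy (f * l) v <->
  l * (\sum_(j < 3) v j * f^`M(j)) + f * along_line v = 0.
Proof.
rewrite /jac_syzygy /along_line !sum3 !mderivM.
by split=> <-; ring.
Qed.

(** As [r1] and [r2] kill [f], their combination takes [f * l] to [f * l * h]; the Euler term
    removes exactly this, [f * l] having degree [d.+1]. *)
Lemma lift_syzygyP a b h : a * alpha + b * beta = l * h -> jac_syzygy (f * l) (lift_syzygy a b h).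
Proof.
move=> rel; apply/jac_syzygyM.
have ef : \sum_(j < 3) lift_syzygy a b h j * f^`M(j) = - ((d.+1%:R^-1)%:MP * h * (d%:R * f)).
  transitivity (a * (\sum_(j < 3) r1 j * f^`M(j)) + b * (\sum_(j < 3) r2 j * f^`M(j))
     - (d.+1%:R^-1)%:MP * h * (d%:R * f)); last by rewrite s1 s2 !mulr0 !add0r.
  by rewrite -euler_f !sum3 /lift_syzygy; ring.
have el : along_line (lift_syzygy a b h) = l * h - (d.+1%:R^-1)%:MP * h * l.
  by rewrite -rel -[in RHS](euler_l) /along_line !sum3 /lift_syzygy; ring.
rewrite ef el.
transitivity (f * l * h * (1 - (d.+1%:R^-1)%:MP * d.+1%:R)); last by rewrite invd subrr mulr0.
by rewrite -natr1; ring.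
Qed.

(** As [l] is prime and does not divide [f], it divides the value of [v] at [l]. With [k] the
    quotient, adding [k / d] times the Euler field yields a syzygy of [f]. *)
Lemma lift_syzygy_surj v : jac_syzygy (f * l) v ->
  exists a b h, a * alpha + b * beta = l * h /\ forall j, v j = lift_syzygy a b h j.
Proof.
move/jac_syzygyM => hv.
have [|//|[k kE]] := @linear_form_prime _ _ l f (along_line v) l_neq0 hl.
  exists (- (\sum_(j < 3) v j * f^`M(j))); apply/eqP; rewrite -subr_eq0.
  by apply/eqP; rewrite -[RHS]hv; ring.
have vf : \sum_(j < 3) v j * f^`M(j) = - (f * k).
  apply: (mulfI l_neq0); apply/eqP; rewrite -subr_eq0; apply/eqP; rewrite -[RHS]hv kE; ring.
have d_inv : (d%:R^-1)%:MP * d%:R = 1 :> S by case: (d) d_gt0 => // d' _; exact: invd.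
have [a [b vE]] : exists a b, forall j, v j + (d%:R^-1)%:MP * k * 'X_j = a * r1 j + b * r2 j.
  apply: span; rewrite /jac_syzygy.
  transitivity (\sum_(j < 3) v j * f^`M(j) + (d%:R^-1)%:MP * k * (d%:R * f)).
    by rewrite -euler_f !sum3; ring.
  rewrite vf; transitivity (f * k * ((d%:R^-1)%:MP * d%:R - 1)); first by ring.
  by rewrite d_inv subrr mulr0.
(* The corrected field takes [l] to [(1 + 1 / d) * k * l], and [(1 + 1 / d) / (d + 1) = 1 / d]
   recovers the correction. *)
exists a, b, ((1 + (d%:R^-1)%:MP) * k); split.
  transitivity (along_line v + (d%:R^-1)%:MP * k * l); last by rewrite kE; ring.
  transitivity (along_line (fun j => a * r1 j + b * r2 j)).
    by rewrite /along_line !sum3; ring.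
  rewrite -[in RHS]euler_l /along_line !sum3 -!vE; ring.
move=> j; rewrite /lift_syzygy -vE.
have -> : (d.+1%:R^-1)%:MP * ((1 + (d%:R^-1)%:MP) * k) = (d%:R^-1)%:MP * k.
  transitivity ((d.+1%:R^-1)%:MP * ((d%:R^-1)%:MP * d%:R + (d%:R^-1)%:MP) * k); first by rewrite d_inv; ring.
  transitivity ((d%:R^-1)%:MP * k * ((d.+1%:R^-1)%:MP * d.+1%:R)); first by rewrite -natr1; ring.
  by rewrite invd mulr1.
by ring.
Qed.

(** Applying a zero lift to [f] gives [h = 0]. What is left is a relation between [r1] and [r2];
    crossing it with [r2] and then with [r1] kills [a] and [b]. *)
Lemma lift_syzygy_neq0 a b h j0 : cross r1 r2 j0 != 0 -> a * alpha + b * beta = l * h ->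
  (a != 0) || (b != 0) -> ~ forall j, lift_syzygy a b h j = 0.
Proof.
move=> N0 rel ab0 z; have := lift_syzygyP rel.
have ef : (d.+1%:R^-1)%:MP * h * (d%:R * f) = 0.
  transitivity (a * (\sum_(j < 3) r1 j * f^`M(j)) + b * (\sum_(j < 3) r2 j * f^`M(j))
     - \sum_(j < 3) lift_syzygy a b h j * f^`M(j)).
    by rewrite -euler_f !sum3 /lift_syzygy; ring.
  by rewrite s1 s2 !sum3 !z; ring.
have [f0 _] := fred.
have h0 : h = 0.
  have e : f * h * (d%:R * d.+1%:R) = 0.
    transitivity (((d.+1%:R^-1)%:MP * h * (d%:R * f)) * (d.+1%:R * d.+1%:R)).
      transitivity (f * h * d%:R * ((d.+1%:R^-1)%:MP * d.+1%:R) * d.+1%:R); last by ring.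
      by rewrite invd; ring.
    by rewrite ef mul0r.
  have dd : d%:R * d.+1%:R != 0 :> S.
    by rewrite -natrM -mpolyC_nat mpolyC_eq0 pnatr_eq0 -lt0n muln_gt0 d_gt0.
  by move/eqP: e; rewrite !mulf_eq0 (negbTE f0) -mulf_eq0 (negbTE dd) orbF => /eqP.
have ab j : a * r1 j + b * r2 j = 0 by rewrite -(z j) /lift_syzygy h0; ring.
have aN j : a * cross r1 r2 j = 0.
  move: j; apply: ord3P; rewrite /cross /=.
  - transitivity ((a * r1 i1 + b * r2 i1) * r2 i2 - (a * r1 i2 + b * r2 i2) * r2 i1); first by ring.
    by rewrite !ab; ring.
  - transitivity ((a * r1 i2 + b * r2 i2) * r2 i0 - (a * r1 i0 + b * r2 i0) * r2 i2); first by ring.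
    by rewrite !ab; ring.
  transitivity ((a * r1 i0 + b * r2 i0) * r2 i1 - (a * r1 i1 + b * r2 i1) * r2 i0); first by ring.
  by rewrite !ab; ring.
have a0 : a = 0 by apply/eqP; have /eqP := aN j0; rewrite mulf_eq0 (negbTE N0) orbF.
have bN j : b * cross r1 r2 j = 0.
  have br j' : b * r2 j' = 0 by rewrite -(ab j') a0; ring.
  move: j; apply: ord3P; rewrite /cross /=.
  - by transitivity (r1 i1 * (b * r2 i2) - r1 i2 * (b * r2 i1)); [ring|rewrite !br; ring].
  - by transitivity (r1 i2 * (b * r2 i0) - r1 i0 * (b * r2 i2)); [ring|rewrite !br; ring].
  by transitivity (r1 i0 * (b * r2 i1) - r1 i1 * (b * r2 i0)); [ring|rewrite !br; ring].
have b0 : b = 0 by apply/eqP; have /eqP := bN j0; rewrite mulf_eq0 (negbTE N0) orbF.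
by move: ab0; rewrite a0 b0 eqxx.
Qed.

Lemma lift_gen_system j0 n (deg : 'I_n -> nat) (a b h : 'I_n -> S) :
  cross r1 r2 j0 != 0 ->
  relation_system d1 d2 l alpha beta deg a b h ->
  homog_gen_system (f * l) deg (fun k => lift_syzygy (a k) (b k) (h k)).
Proof.
move=> N0 [rel nz hom gens]; split=> [k|v /lift_syzygy_surj[x [y [z [rel' vE]]]]].
  split; first exact: lift_syzygy_neq0 N0 (rel k) (nz k).
  split; last exact: lift_syzygyP.
  have [ha hb] := hom k.
  have hr : a k * alpha + b k * beta \is (deg k).-homog.
    by apply: rpredD; [apply: homog_aboveM ha _|apply: homog_aboveM hb _]; exact: along_line_homog.
  (* [l * h k] has degree [deg k], and ['X_j] has the same degree as [l]. *)
  have hX j : h k * 'X_j \is (deg k).-homog.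
    have [->|h0] := eqVneq (h k) 0; first by rewrite mul0r dhomog0.
    rewrite rel in hr; have [|x [e [hl' hh <-]]] := dhomog_factors _ hr; first by rewrite mulf_neq0.
    rewrite -(dhomog_uniq l_neq0 hl hl') addnC; apply: dhomogM => //.
    by rewrite dhomogX; apply/eqP; exact: mdeg1.
  move=> j; apply: rpredB; last by rewrite -mulrA mul_mpolyC; apply: rpredZ; exact: hX.
  by apply: rpredD; [exact: homog_aboveM ha (h1 j)|exact: homog_aboveM hb (h2 j)].
have [c [xE yE]] := gens _ _ _ rel'.
(* Since [l] cancels, [z] is the same combination of the [h k], and the lift is linear in the
   triple. *)
have zE : z = \sum_k c k * h k.
  apply: (mulfI l_neq0); rewrite -rel' xE yE !mulr_suml mulr_sumr -big_split /=.
  by apply: eq_bigr => k _; rewrite mulrCA -rel; ring.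
exists c => j; rewrite vE /lift_syzygy xE yE zE.
rewrite !mulr_sumr !mulr_suml -big_split -sumrB /=.
by apply: eq_bigr => k _; ring.
Qed.

End AddLine.

Lemma addition_dichotomy d d1 d2 f l (r1 r2 : 'I_3 -> S) : (0 < d)%N -> f \is d.-homog -> reduced f ->
  l != 0 -> l \is 1.-homog -> ~ divides l f ->
  homog_triple d1 r1 -> homog_triple d2 r2 -> jac_syzygy f r1 -> jac_syzygy f r2 ->
  (forall v, jac_syzygy f v -> exists a b, forall j, v j = a * r1 j + b * r2 j) ->
  (d1 <= d2)%N -> free_curve (f * l) \/ plus_one_generated d.+1 (f * l).
Proof.
move=> d0 hf fred l0 hl nlf h1 h2 s1 s2 span d12; have [f0 _] := fred.
have [d12d [j0 N0]] := free_degrees hf d0 fred h1 h2 s1 s2 span.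
have hfl : f * l \is d.+1.-homog by rewrite -[d.+1]addn1; exact: dhomogM.
have lower n deg gen : @homog_gen_system R (f * l) n deg gen -> (2 <= n)%N.
  by apply: two_le_gens hfl _ _; rewrite ?mulf_neq0.
have lift n (deg : 'I_n -> nat) a b h := @lift_gen_system d d1 d2 f l r1 r2 d0 hf fred l0 hl nlf
  h1 h2 s1 s2 span j0 n deg a b h N0.
have [[deg [a [b [h /lift sys]]]]|[e [a [b [h [d2e /lift sys]]]]]] :=
  relation_system_exists l0 hl (along_line_homog hl h1) (along_line_homog hl h2) d12.
  by left; split=> [|n deg' gen /lower //]; do 2 eexists; exact: sys.
(* Minimality of the three generators is decided classically: if two suffice the curve is free,
   otherwise three is the minimum. *)
have [[n [deg [gen [n2 sys2]]]]|no2] := classic (exists n deg gen,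
    (n <= 2)%N /\ @homog_gen_system R (f * l) n deg gen).
  have n2' : n = 2 by apply/eqP; rewrite eqn_leq n2 (lower _ _ _ sys2).
  by left; subst n; split=> [|n' deg' gen' /lower //]; exists deg, gen.
right; split; first split.
- by do 2 eexists; exact: sys.
- move=> n deg gen sys'; rewrite ltnNge; apply/negP => n2; apply: no2.
  by exists n, deg, gen.
do 2 eexists; split; first exact: sys.
(* Here [d1.+1 + d2.+1 = d.-1 + 2], which equals [d.+1] because [d] is positive. *)
split; last by rewrite !inordK //= addSn addnS d12d; case: (d) d0.
by move=> [[|[|[|//]]] lti] [[|[|[|//]]] ltj] //= _; lia.
Qed.

End Curves.

Theorem theorem1p2 (R : realType) (d : nat) (f l : {mpoly R[i][3]}) :
  (3 <= d)%N ->
  f \is d.-homog -> reduced f ->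
  l != 0 -> l \is 1.-homog ->
  ~ (exists h, f = l * h) ->
  free_curve f ->
  free_curve (f * l) \/ plus_one_generated d.+1 (f * l).
Proof.
move=> d3 hf fred l0 hl nlf [[deg [gen [gens span]]] _].
have d0 : (0 < d)%N by exact: leq_trans d3.
have nlf' : ~ divides l f by case=> h fE; apply: nlf; exists h; rewrite fE mulrC.
have [[_ [h1 s1]] [_ [h2 s2]]] := (gens ord0, gens (lift ord0 ord0)).
have span' v : jac_syzygy f v ->
    exists a b, forall j, v j = a * gen ord0 j + b * gen (lift ord0 ord0) j.
  move=> /span[c vE]; exists (c ord0), (c (lift ord0 ord0)) => j.
  by rewrite vE !big_ord_recl big_ord0 addr0.
have [d12|/ltnW d21] := leqP (deg ord0) (deg (lift ord0 ord0)).
  exact: addition_dichotomy span' d12.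
apply: (addition_dichotomy d0 hf fred l0 hl nlf' h2 h1 s2 s1 _ d21) => v /span'[a [b vE]].
by exists b, a => j; rewrite vE addrC.
Qed.
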